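(* On the line segment $[0, \ell] \subseteq \mathbb{R}$ of length $\ell > 0$ (with the usual metric), the uniform measure exists and is Lebesgue measure restricted to $[0, \ell]$, normalised to a probability measure.
   Context: For a metric space $X = (X,d)$ and $t>0$, $tX$ is the set $X$ with the metric $t d$. $P(X)$ is the set of (Radon) probability measures on $X$, with the weak* topology as a subset of the dual of $C(X)$. For a compact metric space $X=(X,d)$ and $\mu \in P(X)$, put $(K\mu)(x) = \int_X e^{-d(x,y)}\, d\mu(y)$. The diversity of order $q \in [0,\infty]$ of $\mu$ is $D_q^X(\mu) = \left( \int_X (K\mu)^{q-1}\, d\mu \right)^{1/(1-q)}$ for $q \neq 1,\infty$; $D_1^X(\mu) = \exp\left(-\int_X \log(K\mu)\, d\mu\right)$; $D_\infty^X(\mu) = 1/\operatorname{ess\,sup}_\mu K\mu$. A probability measure $\mu$ on $X$ is maximising if for every $q \in [0,\infty]$ it maximises $D_q^X$ over $P(X)$. The maximising measures on $tX$ are those defined with respect to the metric $td$ (kernel $e^{-t d(x,y)}$), regarded as probability measures on the fixed set $X$. Uniform measure: suppose that $tX$ has a unique maximising measure $\mu_t$ for all sufficiently large $t$, and that $\lim_{t\to\infty}\mu_t$ exists in $P(X)$. Then the uniform measure on $X$ is said to exist, and it is $\mu_X = \lim_{t\to\infty}\mu_t$. *)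

(* Defs.v *)
From HB Require Import structures.
From mathcomp Require Import all_boot all_order all_algebra.
From mathcomp Require Import all_classical all_reals all_analysis.
From mathcomp Require Import measurable_realfun ess_sup_inf.

Set Implicit Arguments.
Unset Strict Implicit.
Unset Printing Implicit Defensive.

Import Order.TTheory GRing.Theory Num.Theory.
Import numFieldNormedType.Exports.

Local Open Scope classical_set_scope.
Local Open Scope ring_scope.

(* The library's measurable types are pointed, so only nonempty metric spaces
   carry a Borel structure here. *)
#[short(type="pmetricType")]
HB.structure Definition PointedMetric (R : numDomainType) :=
  { X of Pointed X & Metric R X }.

(* Diversity with respect to a distance function, which is kept apart from the
   structure of the carrier so that tX can live on the same carrier as X. *)
Section diversity.
Context d (T : measurableType d) (R : realType).
Variable dist : T -> T -> R.

Definition Kmeas (mu : probability T R) (x : T) : R :=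
  \int[mu]_y expR (- dist x y).

(* On a compact metric space K mu is continuous and positive, so that every
   integral and essential supremum below is finite. The value at q = -oo is
   irrelevant, since only orders q >= 0 are considered. *)
Definition diversity (q : \bar R) (mu : probability T R) : R :=
  match q with
  | q%:E => if q == 1 then expR (- \int[mu]_x ln (Kmeas mu x))
            else (\int[mu]_x (Kmeas mu x `^ (q - 1))) `^ (1 - q)^-1
  | +oo%E => (fine (ess_sup mu (EFin \o Kmeas mu)))^-1
  | -oo%E => 0
  end.

Definition maximising (mu : probability T R) :=
  forall q : \bar R, (0 <= q)%E ->
  forall nu : probability T R, diversity q nu <= diversity q mu.

(* Measures are functions on all subsets of T, with unconstrained values off
   the sigma-algebra, so uniqueness is up to agreement on measurable sets
   rather than Leibniz equality. *)
Definition unique_maximising (mu : probability T R) :=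
  maximising mu /\
  forall nu : probability T R, maximising nu ->
    forall A, measurable A -> nu A = mu A.

End diversity.

Section uniform_measure.
Context (R : realType) (X : pmetricType R).

Definition borel := g_sigma_algebraType (@open X).

(* On a compact metric space, every Borel probability measure is Radon. *)
Definition prob := probability borel R.

Definition integration (mu : prob) : {ptws continuousType X R -> R} :=
  fun f => \int[mu]_x f x.

(* The weak* topology, i.e. that of pointwise convergence on C(X). *)
HB.instance Definition _ := Choice.on prob.
HB.instance Definition _ :=
  Topological.copy prob (initial_topology integration).

Lemma cvg_weak_star (F : set_system prob) (mu : prob) : Filter F ->
  F --> mu <-> forall f : continuousType X R,
    integration nu f @[nu --> F] --> integration mu f.
Proof.
move=> FF; split=> [Fmu f|Fmu].
  have cint : continuous (integration : prob -> _).
    exact: (@initial_continuous _ _ integration).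
  have : {ptws, integration @ F --> integration mu}.
    exact: cvg_comp Fmu (cint mu).
  rewrite cvg_sup => /(_ f) Fmuf A.
  pose ev (g : {ptws continuousType X R -> R}) := g f.
  by move=> /(@initial_continuous _ _ ev (integration mu)) /Fmuf.
suff Hptws : {ptws, integration @ F --> integration mu}.
  move=> A [_ [[B oB <-] Bmu BA]].
  have /Hptws : nbhs (integration mu : {ptws continuousType X R -> R}) B.
    exact: open_nbhs_nbhs.
  exact: (@filterS _ F FF (integration @^-1` B) A BA).
rewrite cvg_sup => f A [_ [[B oB <-] Bmu BA]].
have /(Fmu f) : nbhs (integration mu f) B by exact: open_nbhs_nbhs.
by apply: (@filterS _ F FF) => nu Bnu; exact: BA.
Qed.

(* The distance of tX. For t > 0 it has the same Borel sets as that of X. *)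
Definition scaled_dist (t : R) (x y : borel) : R :=
  t * mdist (x : X) (y : X).

(* Intended for compact X. The values m t for small t are irrelevant. *)
Definition is_uniform_measure (mu : prob) :=
  exists m : R -> prob,
    (\forall t \near +oo, unique_maximising (scaled_dist t) (m t)) /\
    m t @[t --> +oo] --> mu.

End uniform_measure.

(* The proof that 0 < l is an argument, as it provides the point 0. *)
Definition segment (R : realType) (l : R) (_ : 0 < l) : Type :=
  (`[0, l]%classic : set R).

Section segment.
Context (R : realType) (l : R) (l0 : 0 < l).
Local Notation X := (segment l0).

HB.instance Definition _ := PseudoMetric.copy X (`[0, l]%classic : set R).

Definition seg_val : X -> R := set_val.

Let seg0 : (0 : R) \in (`[0, l]%classic : set R).
Proof. by rewrite inE /= in_itv /= lexx ltW. Qed.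

HB.instance Definition _ := isPointed.Build X (exist _ 0 seg0).

Let dist (x y : X) : R := `|seg_val x - seg_val y|.

Let dist_ge0 x y : 0 <= dist x y. Proof. exact: normr_ge0. Qed.

Let dist_positivity x y : dist x y = 0 -> x = y.
Proof. by move/normr0_eq0/subr0_eq; exact: val_inj. Qed.

Let ballEdist x e : ball x e = [set y | dist x y < e].
Proof. by rewrite -[LHS]initial_ballE. Qed.

HB.instance Definition _ := PseudoMetric_isMetric.Build R X
  dist_ge0 dist_positivity ballEdist.

Lemma mdist_segment (x y : X) : mdist x y = `|seg_val x - seg_val y|.
Proof. by []. Qed.

Lemma compact_segment : compact [set: X].
Proof.
move=> F FF _.
have [|x [x0l Fx]] := @segment_compact R 0 l (seg_val @ F).
  by apply: (@filterS _ F _ setT) (@filterT _ F _) => y _; exact: set_valP.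
exists (exist _ x (mem_set x0l)); split => // B C FB.
case=> _ [[U oU <-] /= Ux UC].
have : (seg_val @` B `&` U) !=set0.
  apply: Fx; last exact: open_nbhs_nbhs.
  by apply: (@filterS _ F _ B) FB => y By; exists y.
by case=> _ [[y By <-] Uy]; exists y; split => //; exact: UC.
Qed.

Lemma measurable_seg_val (A : set (borel X)) :
  measurable A -> measurable (seg_val @` A).
Proof.
pose G := [set B : set X | measurable (seg_val @` B)].
suff : <<s @open X >> `<=` G by apply.
apply: smallest_sub.
- split.
  + by rewrite /G /= image_set0.
  + move=> B GB; rewrite /G /= setTD.
    have -> : seg_val @` (~` B) = `[0, l]%classic `\` seg_val @` B.
      apply/seteqP; split=> [_ [x nBx <-]|y [y0l nBy]].
        split; first exact: set_valP.
        by move=> [z Bz /val_inj zx]; apply: nBx; rewrite -zx.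
      exists (exist _ y (mem_set y0l)) => // By.
      by apply: nBy; exists (exist _ y (mem_set y0l)).
    exact: measurableD.
  + move=> F GF; rewrite /G /= image_bigcup.
    by apply: bigcup_measurable => k _; exact: GF.
- move=> B [U oU <-]; rewrite /G /=.
  have -> : seg_val @` (seg_val @^-1` U) = `[0, l]%classic `&` U.
    apply/seteqP; split=> [_ [x Ux <-]|y [y0l Uy]].
      by split => //; exact: set_valP.
    by exists (exist _ y (mem_set y0l)).
  by apply: measurableI => //; exact: open_measurable.
Qed.

Definition lebesgue_segment (A : set (borel X)) : \bar R :=
  lebesgue_measure (seg_val @` A).

Let lebesgue_segment0 : lebesgue_segment set0 = 0%E.
Proof. by rewrite /lebesgue_segment image_set0 measure0. Qed.

Let lebesgue_segment_ge0 A : (0 <= lebesgue_segment A)%E.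
Proof. exact: measure_ge0. Qed.

Let lebesgue_segment_sigma_additive : semi_sigma_additive lebesgue_segment.
Proof.
move=> F mF tF mUF; rewrite /lebesgue_segment image_bigcup.
apply: measure_semi_sigma_additive.
- by move=> i; exact: measurable_seg_val.
- apply/trivIsetP => i j _ _ ij; apply/seteqP; split => // y [[x Fx <-] [z Fz]].
  move=> /val_inj zx; rewrite zx in Fz.
  have /trivIsetP /(_ i j I I ij) /seteqP [FiFj _] := tF.
  exact: (FiFj x (conj Fx Fz)).
- by rewrite -image_bigcup; exact: measurable_seg_val.
Qed.

HB.instance Definition _ := isMeasure.Build _ _ _ lebesgue_segment
  lebesgue_segment0 lebesgue_segment_ge0 lebesgue_segment_sigma_additive.

(* The second argument of [mnormalize] is a fallback for measures of total mass
   0 or +oo; it plays no role here, see [normalised_lebesgueE]. *)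
Definition normalised_lebesgue : prob X :=
  mnormalize lebesgue_segment (dirac point).

Lemma lebesgue_segmentT : lebesgue_segment setT = l%:E.
Proof.
rewrite /lebesgue_segment; have -> : seg_val @` setT = `[0, l]%classic.
  apply/seteqP; split=> [_ [x _ <-]|y y0l]; first exact: set_valP.
  by exists (exist _ y (mem_set y0l)).
by rewrite lebesgue_measure_itv /= lte_fin l0 oppr0 adde0.
Qed.

Lemma normalised_lebesgueE (A : set (borel X)) :
  normalised_lebesgue A = (lebesgue_measure (seg_val @` A) * l^-1%:E)%E.
Proof.
have lT := lebesgue_segmentT.
by rewrite /normalised_lebesgue /= /mnormalize /= [lebesgue_segment _]lT eqe gt_eqF.
Qed.

End segment.

(* Main.v *)
(* Put phi_s(x) = e^{-t(s-x)} for x <= s and 0 otherwise, m for normalised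
   Lebesgue measure on [0, l] and theta = t l. Then
     e^{-t|x-y|} = phi_l(x) phi_l(y) + 2 theta \int phi_s(x) phi_s(y) dm(s),
     1 = phi_l(x) + theta \int phi_s(x) dm(s).
   For a probability nu let B_s = \int phi_s dnu, so that
   K nu = phi_l B_l + 2 theta \int phi_s B_s dm(s). By Cauchy-Schwarz
     1 / K nu <= phi_l / B_l + (theta/2) \int phi_s / B_s dm(s),
   and integrating against nu gives D_0(nu) <= 1 + theta/2; the Bernoulli
   inequality transfers the bound to every order q. The balanced measure
   mu_t = (delta_0 + delta_l + theta m) / (2 + theta) has constant potential
   2 / (2 + theta), hence attains the bound at every q. Conversely, equality at
   q = 2 makes the energy B_l^2 + 2 theta \int B_s^2 dm(s) minimal under the
   constraint B_l + theta \int B_s dm(s) = 1, so B is m-almost everywhere equal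
   to 1 / (2 + theta), which determines the distribution function of nu. Clearly
   mu_t tends to m as t tends to infinity. *)
Require Import Defs.
From mathcomp Require Import all_boot all_order all_algebra.
From mathcomp Require Import all_classical all_reals all_analysis.
From mathcomp Require Import measurable_realfun ess_sup_inf ring lra.

Set Implicit Arguments.
Unset Strict Implicit.
Unset Printing Implicit Defensive.

Import Order.TTheory GRing.Theory Num.Theory.
Import numFieldNormedType.Exports.

Local Open Scope classical_set_scope.
Local Open Scope ring_scope.

(** * Bounded measurable functions *)

Section bounded_measurable.
Context d (T : measurableType d) (R : realType).
Implicit Types f g : T -> R.

(** Stable under sums, products and partial integration, and integrable against every finite
    measure: one class serves the integrability and Fubini conditions below. *)
Definition bounded_measurable f :=
  measurable_fun setT f /\ exists M, forall x, `|f x| <= M.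

Lemma bounded_measurable_cst (r : R) : bounded_measurable (fun=> r).
Proof. by split; [exact: measurable_cst|exists `|r|]. Qed.

Lemma bounded_measurableD f g : bounded_measurable f -> bounded_measurable g ->
  bounded_measurable (fun x => f x + g x).
Proof.
move=> [mf [M Mf]] [mg [N Ng]]; split; first exact: measurable_funD.
by exists (M + N) => x; rewrite (le_trans (ler_normD _ _))// lerD.
Qed.

Lemma bounded_measurableM f g : bounded_measurable f -> bounded_measurable g ->
  bounded_measurable (fun x => f x * g x).
Proof.
move=> [mf [M Mf]] [mg [N Ng]]; split; first exact: measurable_funM.
by exists (M * N) => x; rewrite normrM ler_pM.
Qed.

Lemma bounded_measurable_if (b : T -> bool) f g : measurable_fun setT b ->
  bounded_measurable f -> bounded_measurable g ->
  bounded_measurable (fun x => if b x then f x else g x).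
Proof.
move=> mb [mf [M Mf]] [mg [N Ng]]; split; first exact: measurable_fun_ifT.
by exists (Num.max M N) => x; rewrite le_max; case: ifP;
  rewrite ?Mf ?Ng ?orbT.
Qed.

Lemma bounded_measurable_integrable (P : {finite_measure set T -> \bar R}) f :
  bounded_measurable f -> P.-integrable setT (EFin \o f).
Proof.
move=> [mf [M Mf]]; apply: measurable_bounded_integrable => //.
  by rewrite ltey_eq fin_num_measure.
exists M; split; first exact: num_real.
by move=> x Mx y _ /=; rewrite (le_trans (Mf y))// ltW.
Qed.

Lemma Rintegral_probability_cst (P : probability T R) (r : R) :
  \int[P]_x r = r.
Proof. by rewrite Rintegral_cst// [X in fine X]probability_setT mulr1. Qed.

End bounded_measurable.

(** * Partial integrals and Fubini's theorem for bounded functions *)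

Section bounded_fubini.
Context d1 d2 (T1 : measurableType d1) (T2 : measurableType d2) (R : realType).
Variable Q : probability T2 R.
Variable f : T1 -> T2 -> R.
Hypothesis bf : bounded_measurable (fun p : T1 * T2 => f p.1 p.2).

Lemma bounded_measurable_section1 x : bounded_measurable (f x).
Proof.
case: bf => mf [M Mf]; split; last by exists M => y; exact: (Mf (x, y)).
exact: (measurableT_comp mf (pair1_measurable x)).
Qed.

Lemma bounded_measurable_section2 y : bounded_measurable (f ^~ y).
Proof.
case: bf => mf [M Mf]; split; last by exists M => x; exact: (Mf (x, y)).
exact: (measurableT_comp mf (pair2_measurable y)).
Qed.

Lemma bounded_measurable_integrable_prod (P : probability T1 R) :
  (P \x Q)%E.-integrable setT (EFin \o (fun p : T1 * T2 => f p.1 p.2)).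
Proof.
case: bf => mf [M Mf]; apply: measurable_bounded_integrable => //.
  have := @product_measure1E _ _ _ _ R P Q _ _ measurableT measurableT.
  rewrite setXTT [X in (X * _)%E]probability_setT.
  by rewrite [X in (_ * X)%E]probability_setT mule1 => /= ->; rewrite ltry.
exists M; split; first exact: num_real.
by move=> x Mx y _ /=; rewrite (le_trans (Mf y))// ltW.
Qed.

Lemma bounded_measurable_Rintegral :
  bounded_measurable (fun x => \int[Q]_y f x y).
Proof.
split.
  apply/measurable_EFinP.
  (* Measurability of the partial integral does not depend on a measure on [T1]; [dirac point]
     supplies the probability that the product measure asks for. *)
  have := measurable_fubini_F
    (bounded_measurable_integrable_prod (dirac point)).
  apply: eq_measurable_fun => x _ /=; rewrite /fubini_F /= fineK//.
  apply: integrable_fin_num => //.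
  by apply: bounded_measurable_integrable; exact: bounded_measurable_section1.
case: bf => mf [M Mf]; exists M => x.
have bx := bounded_measurable_section1 x.
rewrite (le_trans (le_normr_Rintegral _ _))//.
  exact: bounded_measurable_integrable.
rewrite -[leRHS](Rintegral_probability_cst Q); apply: le_Rintegral => //.
- apply: bounded_measurable_integrable; split.
    by apply: measurableT_comp => //; case: bx.
  by exists M => y; rewrite normr_id; exact: (Mf (x, y)).
- by apply: bounded_measurable_integrable; exact: bounded_measurable_cst.
- by move=> y _; exact: (Mf (x, y)).
Qed.

End bounded_fubini.

Lemma Rintegral_swap d1 d2 (T1 : measurableType d1) (T2 : measurableType d2)
    (R : realType) (P : probability T1 R) (Q : probability T2 R)
    (f : T1 -> T2 -> R) :
  bounded_measurable (fun p : T1 * T2 => f p.1 p.2) ->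
  \int[P]_x \int[Q]_y f x y = \int[Q]_y \int[P]_x f x y.
Proof.
move=> bf; rewrite /Rintegral; congr fine.
have E1 x : (\int[Q]_y f x y)%:E = (\int[Q]_y (f x y)%:E)%E.
  rewrite /Rintegral fineK//; apply: integrable_fin_num => //.
  apply: bounded_measurable_integrable.
  exact: bounded_measurable_section1 bf _.
have E2 y : (\int[P]_x f x y)%:E = (\int[P]_x (f x y)%:E)%E.
  rewrite /Rintegral fineK//; apply: integrable_fin_num => //.
  apply: bounded_measurable_integrable.
  exact: bounded_measurable_section2 bf _.
under eq_integral do rewrite E1.
under [in RHS]eq_integral do rewrite E2.
apply: (@Fubini _ _ _ _ _ P Q (EFin \o (fun p : T1 * T2 => f p.1 p.2))).
exact: bounded_measurable_integrable_prod.
Qed.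

(** * Linearity and monotonicity of the integral on bounded functions *)

Section bounded_integral.
Context d (T : measurableType d) (R : realType) (P : probability T R).
Implicit Types f g : T -> R.

Lemma bounded_RintegralD f g : bounded_measurable f -> bounded_measurable g ->
  \int[P]_x (f x + g x) = \int[P]_x f x + \int[P]_x g x.
Proof.
by move=> bf bg; rewrite RintegralD//; exact: bounded_measurable_integrable.
Qed.

Lemma bounded_RintegralZl (r : R) f : bounded_measurable f ->
  \int[P]_x (r * f x) = r * \int[P]_x f x.
Proof.
by move=> bf; rewrite RintegralZl//; exact: bounded_measurable_integrable.
Qed.

Lemma bounded_RintegralZr (r : R) f : bounded_measurable f ->
  \int[P]_x (f x * r) = \int[P]_x f x * r.
Proof.
by move=> bf; rewrite RintegralZr//; exact: bounded_measurable_integrable.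
Qed.

Lemma bounded_le_Rintegral f g : bounded_measurable f -> bounded_measurable g ->
  (forall x, f x <= g x) -> \int[P]_x f x <= \int[P]_x g x.
Proof.
by move=> bf bg fg; apply: le_Rintegral => //;
  exact: bounded_measurable_integrable.
Qed.

End bounded_integral.

Ltac bounded := repeat first
  [ assumption | exact: bounded_measurable_cst
  | apply: bounded_measurableD | apply: bounded_measurableM ].

(** * Kernels that factor through layers: potential, energy, and the mean of the inverse
    potential *)

Section factored_kernel.
Context d (T : measurableType d) (R : realType) (m : probability T R).
Variables (phi : T -> T -> R) (top : T) (theta kappa : R).
Hypothesis mphi : measurable_fun setT (fun p : T * T => phi p.1 p.2).
Hypothesis phi01 : forall s x, 0 <= phi s x <= 1.
Hypothesis kappa0 : 0 < kappa.
Hypothesis phi_top : forall x, kappa <= phi top x.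
Hypothesis theta0 : 0 < theta.
Hypothesis phi_sum : forall x, phi top x + theta * \int[m]_s phi s x = 1.

Let bphi : bounded_measurable (fun p : T * T => phi p.1 p.2).
Proof.
split=> //; exists 1 => -[s x].
by case/andP: (phi01 s x) => ? ?; rewrite ger0_norm.
Qed.

Let bphi1 s : bounded_measurable (phi s).
Proof. exact: bounded_measurable_section1 bphi s. Qed.

Let bphi2 x : bounded_measurable (phi ^~ x).
Proof. exact: bounded_measurable_section2 bphi x. Qed.

Let bphiM (h : T -> R) : bounded_measurable h ->
  bounded_measurable (fun p : T * T => phi p.2 p.1 * h p.2).
Proof.
move=> [mh [M Mh]]; apply: bounded_measurableM; split.
- exact: (measurableT_comp mphi
    (measurable_fun_pair measurable_snd measurable_fst)).
- by exists 1 => -[x s]; case/andP: (phi01 s x) => ? ?; rewrite ger0_norm.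
- exact: (measurableT_comp mh measurable_snd).
- by exists M => p; exact: Mh.
Qed.

Lemma bounded_Rintegral_layers h : bounded_measurable h ->
  bounded_measurable (fun x => \int[m]_s (phi s x * h s)).
Proof.
move=> bh.
exact: (bounded_measurable_Rintegral m (f := fun x s => phi s x * h s)
  (bphiM bh)).
Qed.

Variable nu : probability T R.

Definition layer_mass (s : T) : R := \int[nu]_x phi s x.
Local Notation B := layer_mass.

(** The potential of [nu] for the kernel phi_top(x) phi_top(y) + 2 theta \int phi_s(x) phi_s(y)
    dm(s), with the integral over y already carried out; [Rintegral_factored_kernel] is the
    identification. *)
Definition factored_potential (x : T) : R :=
  phi top x * B top + 2 * theta * \int[m]_s (phi s x * B s).
Local Notation g := factored_potential.

Lemma bounded_layer_mass : bounded_measurable B.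
Proof. exact: (bounded_measurable_Rintegral nu (f := phi) bphi). Qed.
Let bB := bounded_layer_mass.

Lemma layer_mass_ge0 s : 0 <= B s.
Proof. by apply: Rintegral_ge0 => x _; case/andP: (phi01 s x). Qed.

Lemma layer_mass_top_ge : kappa <= B top.
Proof.
rewrite -[leLHS](Rintegral_probability_cst nu).
by apply: bounded_le_Rintegral => //; exact: bounded_measurable_cst.
Qed.

(** By Fubini the integral over x can be taken first, and it turns [phi s x] into [B s]. *)
Lemma Rintegral_layers h : bounded_measurable h ->
  \int[nu]_x \int[m]_s (phi s x * h s) = \int[m]_s (B s * h s).
Proof.
move=> bh.
rewrite (Rintegral_swap nu m (f := fun x s => phi s x * h s) (bphiM bh)).
by apply: eq_Rintegral => s _; rewrite bounded_RintegralZr.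
Qed.

Lemma Rintegral_factored_kernel x :
  \int[nu]_y (phi top x * phi top y +
    2 * theta * \int[m]_s (phi s x * phi s y)) = g x.
Proof.
have b1 := bounded_Rintegral_layers (bphi2 x).
transitivity (\int[nu]_y (phi top x * phi top y +
    2 * theta * \int[m]_s (phi s y * phi s x))).
  apply: eq_Rintegral => y _; congr (_ + _ * _).
  by apply: eq_Rintegral => s _; rewrite mulrC.
rewrite bounded_RintegralD; [|by bounded..].
rewrite !bounded_RintegralZl; [|by bounded..].
rewrite (Rintegral_layers (bphi2 x)); congr (_ + _ * _).
by apply: eq_Rintegral => s _; rewrite mulrC.
Qed.

Lemma bounded_factored_potential : bounded_measurable g.
Proof.
by have b1 := bounded_Rintegral_layers bB; have b2 := bphi1 top; bounded.
Qed.
Let bg := bounded_factored_potential.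

(** The top layer alone gives the bound: both of its factors are at least [kappa], and the other
    layers contribute a nonnegative amount. *)
Lemma factored_potential_ge x : kappa ^+ 2 <= g x.
Proof.
rewrite expr2 -[leLHS]addr0 lerD//.
  by rewrite ler_pM// ?(ltW kappa0)// layer_mass_top_ge.
rewrite mulr_ge0 ?mulr_ge0// ?(ltW theta0)//; apply: Rintegral_ge0 => s _.
by rewrite mulr_ge0 ?layer_mass_ge0//; case/andP: (phi01 s x).
Qed.

Let g_gt0 x : 0 < g x.
Proof. by rewrite (lt_le_trans _ (factored_potential_ge x))// exprn_gt0. Qed.

Lemma bounded_inv_factored_potential : bounded_measurable (fun x => (g x)^-1).
Proof.
split.
  case: bg => mg _.
  (* As [g] is positive, its inverse is a real power, and [measurable_powR] applies. *)
  rewrite (_ : (fun _ => _) = (fun x => g x `^ (-1))); last first.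
    by apply/funext => x; rewrite powR_inv1// ltW.
  exact: (measurableT_comp (measurable_powR _) mg).
exists (kappa ^+ 2)^-1 => x; rewrite ger0_norm ?invr_ge0 ?(ltW (g_gt0 x))//.
by rewrite lef_pV2 ?posrE ?exprn_gt0// factored_potential_ge.
Qed.
Let bgV := bounded_inv_factored_potential.

(** [B s] may vanish; the shift by [eps] keeps the inverse below [eps^-1]. *)
Let bounded_inv_layer_mass eps : 0 < eps ->
  bounded_measurable (fun s => (B s + eps)^-1).
Proof.
move=> eps0; have b0 s : 0 < B s + eps by rewrite ltr_wpDl ?layer_mass_ge0.
split.
  case: (bounded_measurableD bB (bounded_measurable_cst T eps)) => mB _.
  rewrite (_ : (fun _ => _) = (fun s => (B s + eps) `^ (-1))); last first.
    by apply/funext => s; rewrite powR_inv1// ltW.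
  exact: (measurableT_comp (measurable_powR _) mB).
exists eps^-1 => s; rewrite ger0_norm ?invr_ge0 ?(ltW (b0 s))//.
by rewrite lef_pV2 ?posrE// lerDr layer_mass_ge0.
Qed.

Lemma layer_mass_sum : B top + theta * \int[m]_s B s = 1.
Proof.
have b1 := bounded_Rintegral_layers (bounded_measurable_cst T 1).
rewrite -[RHS](Rintegral_probability_cst nu).
transitivity (\int[nu]_x (phi top x + theta * \int[m]_s (phi s x * 1)));
    last first.
  apply: eq_Rintegral => x _; rewrite -[RHS](phi_sum x); congr (_ + _ * _).
  by apply: eq_Rintegral => s _; rewrite mulr1.
rewrite bounded_RintegralD; [|by bounded..].
rewrite bounded_RintegralZl// (Rintegral_layers (bounded_measurable_cst T 1)).
by congr (_ + _ * _); apply: eq_Rintegral => s _; rewrite mulr1.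
Qed.

(** The factorisation makes the energy of [nu] a weighted sum of squares of layer masses. *)
Lemma Rintegral_factored_potential :
  \int[nu]_x g x = B top ^+ 2 + 2 * theta * \int[m]_s (B s * B s).
Proof.
have b1 := bounded_Rintegral_layers bB.
rewrite bounded_RintegralD; [|by bounded..].
rewrite bounded_RintegralZl// bounded_RintegralZr// Rintegral_layers//.
Qed.


(** With L = 1 / g(x), the identity L = 2 L - L^2 g(x) is split into layers, the factor 1 of 2 L by
    [phi_sum] and g(x) by its definition. AM-GM then bounds each layer, so that the terms in L^2
    cancel up to an error of order [eps]. *)
Lemma inv_factored_potential_le eps x : 0 < eps ->
  (g x)^-1 <= 2 * eps / kappa ^+ 4 + phi top x / B top +
    theta / 2 * \int[m]_s (phi s x * (B s + eps)^-1).
Proof.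
move=> eps0; set L := (g x)^-1.
have beps : bounded_measurable (fun s => (B s + eps)^-1).
  exact: bounded_inv_layer_mass.
have b1 := bphi2 x.
(* AM-GM on each layer: 2 L <= 2 L^2 b + 1 / (2 b) with b = B s + eps *)
have layer : 2 * L * \int[m]_s phi s x <=
    2 * L ^+ 2 * (\int[m]_s (phi s x * B s) + eps * \int[m]_s phi s x) +
    2^-1 * \int[m]_s (phi s x * (B s + eps)^-1).
  rewrite -!bounded_RintegralZl; [|by bounded..].
  rewrite -bounded_RintegralD; [|by bounded..].
  rewrite -bounded_RintegralZl; [|by bounded..].
  rewrite -bounded_RintegralD; [|by bounded..].
  apply: bounded_le_Rintegral; [by bounded..|] => s.
  have b0 : 0 < B s + eps by rewrite ltr_wpDl ?layer_mass_ge0.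
  rewrite -subr_ge0.
  rewrite [leRHS](_ : _ =
    phi s x * ((B s + eps)^-1 / 2 * (2 * L * (B s + eps) - 1) ^+ 2)).
    apply: mulr_ge0; first by case/andP: (phi01 s x).
    by rewrite mulr_ge0 ?sqr_ge0// divr_ge0 ?invr_ge0// ltW.
  by field; rewrite gt_eqF.
have Bt0 : 0 < B top by exact: lt_le_trans layer_mass_top_ge.
(* The top layer enters the potential with weight 1 instead of 2, hence the different balance 2 L <=
   L^2 b + 1 / b with b = [B top]. *)
have top_layer : 2 * L * phi top x <=
    L ^+ 2 * (phi top x * B top) + phi top x / B top.
  rewrite -subr_ge0 [leRHS](_ : _ =
    phi top x * ((B top)^-1 * (L * B top - 1) ^+ 2)); last first.
    by field; rewrite gt_eqF.
  apply: mulr_ge0; first by case/andP: (phi01 top x).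
  by rewrite mulr_ge0 ?sqr_ge0// invr_ge0 ltW.
have LgL : L ^+ 2 * g x = L by rewrite expr2 -mulrA /L mulVf ?mulr1// gt_eqF.
have Lk : L ^+ 2 <= (kappa ^+ 4)^-1.
  rewrite /L exprVn lef_pV2 ?posrE ?exprn_gt0//.
  rewrite (_ : kappa ^+ 4 = (kappa ^+ 2) ^+ 2); last by rewrite -exprM.
  by rewrite lerXn2r ?nnegrE ?exprn_ge0 ?(ltW kappa0) ?(ltW (g_gt0 x))//
     factored_potential_ge.
have J1 : theta * \int[m]_s phi s x <= 1.
  by rewrite -(phi_sum x) lerDr; case/andP: (phi01 top x).
have tlayer := ler_wpM2l (ltW theta0) layer.
(* Twice this quantity is the cost of replacing [B s] by [B s + eps]; it becomes the first term of
   the bound. *)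
have epsJ : L ^+ 2 * (eps * (theta * \int[m]_s phi s x)) <=
    (kappa ^+ 4)^-1 * eps.
  rewrite ler_pM ?sqr_ge0//.
    rewrite !mulr_ge0 ?(ltW eps0) ?(ltW theta0)//.
    by rewrite Rintegral_ge0// => s _; case/andP: (phi01 s x).
  by rewrite ler_piMr// ltW.
have s1 := phi_sum x.
move: LgL; rewrite /factored_potential => LgL.
set J := \int[m]_s phi s x in layer J1 tlayer epsJ s1 *.
set JB := \int[m]_s (phi s x * B s) in layer tlayer LgL *.
set JH := \int[m]_s (phi s x * (B s + eps)^-1) in layer tlayer *.
have -> : L = 2 * L * (phi top x + theta * J) - L by rewrite s1; ring.
rewrite -[X in _ - X]LgL; lra.
Qed.

(* Weighting each point of the layer s by 1 / B s, every layer carrying mass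
   contributes 1; eps handles the layers of mass 0. *)
Lemma Rintegral_inv_factored_potential_le :
  \int[nu]_x (g x)^-1 <= 1 + theta / 2.
Proof.
apply/ler_addgt0Pl => e e0.
(* Chosen so that the error 2 eps / kappa^4 equals [e]. *)
pose eps := e * kappa ^+ 4 / 2.
have eps0 : 0 < eps by rewrite !mulr_gt0 ?exprn_gt0.
have beps : bounded_measurable (fun s => (B s + eps)^-1).
  exact: bounded_inv_layer_mass.
have b1 := bphi1 top; have b2 := bounded_Rintegral_layers beps.
have Bt0 : 0 < B top by exact: lt_le_trans layer_mass_top_ge.
apply: (@le_trans _ _ (\int[nu]_x (2 * eps / kappa ^+ 4 + phi top x / B top +
    theta / 2 * \int[m]_s (phi s x * (B s + eps)^-1)))).
  apply: bounded_le_Rintegral; [by bounded..|] => x.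
  exact: inv_factored_potential_le.
rewrite !bounded_RintegralD; [|by bounded..].
rewrite bounded_RintegralZl// bounded_RintegralZr// Rintegral_layers//.
rewrite Rintegral_probability_cst -/(B top) mulfV ?gt_eqF//.
have -> : 2 * eps / kappa ^+ 4 = e by rewrite /eps; field; rewrite gt_eqF.
rewrite -addrA lerD2l lerD2l -[leRHS]mulr1 ler_wpM2l ?divr_ge0 ?(ltW theta0)//.
rewrite -[leRHS](Rintegral_probability_cst m).
apply: bounded_le_Rintegral; [by bounded..|] => s.
by rewrite ler_pdivrMr ?mul1r ?lerDl ?(ltW eps0)// ltr_wpDl ?layer_mass_ge0.
Qed.

(** Completing the square under the constraint [layer_mass_sum], the energy minus a is (B_top - a)^2
    + 2 theta V, where a = 1 / (1 + theta / 2) and V is the integral of (B - a / 2)^2. Energy at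
    most a thus forces V = 0. *)
Lemma layer_mass_minimal : \int[nu]_x g x <= (1 + theta / 2)^-1 ->
  {ae m, forall s, B s = (1 + theta / 2)^-1 / 2}.
Proof.
set a := (1 + theta / 2)^-1; rewrite Rintegral_factored_potential => le_a.
have W0 : 0 < 1 + theta / 2 by rewrite ltr_pwDr ?divr_gt0.
have aW : a * (1 + theta / 2) = 1 by rewrite mulVf ?gt_eqF.
have sum1 := layer_mass_sum.
have bD : bounded_measurable (fun s => (B s + - (a / 2)) * (B s + - (a / 2))).
  by bounded.
pose V := \int[m]_s ((B s + - (a / 2)) * (B s + - (a / 2))).
have VE : V = \int[m]_s (B s * B s) + - a * \int[m]_s B s + a ^+ 2 / 4.
  rewrite /V -bounded_RintegralZl//.
  rewrite -[X in _ + X](Rintegral_probability_cst m).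
  rewrite -!bounded_RintegralD; [|by bounded..].
  by apply: eq_Rintegral => s _; field.
have V0 : 0 <= V by apply: Rintegral_ge0 => s _; rewrite -expr2 sqr_ge0.
have le0 : (B top - a) ^+ 2 + 2 * theta * V <= 0.
  (* The first term on the right is nonpositive by hypothesis; the other two vanish by the
     constraint [sum1] and by the choice of [a]. *)
  have -> : (B top - a) ^+ 2 + 2 * theta * V =
    (B top ^+ 2 + 2 * theta * \int[m]_s (B s * B s) - a)
    - 2 * a * (B top + theta * \int[m]_s B s - 1)
    + a * (a * (1 + theta / 2) - 1).
    by rewrite VE; field.
  by rewrite sum1 aW !subrr !mulr0 subr0 addr0 subr_le0.
have t2 : 0 < 2 * theta by rewrite mulr_gt0.
have sq0 := sqr_ge0 (B top - a).
have tV0 : 0 <= 2 * theta * V by rewrite mulr_ge0 // ltW.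
have Vz : V = 0.
  by apply/eqP; rewrite -(mulrI_eq0 _ (mulfI (lt0r_neq0 t2))); apply/eqP; lra.
have : (\int[m]_s `|((B s + - (a / 2)) * (B s + - (a / 2)))%:E| = 0)%E.
  rewrite -[RHS](congr1 EFin Vz) /V /Rintegral fineK.
    by apply: eq_integral => s _; rewrite gee0_abs// lee_fin -expr2 sqr_ge0.
  by apply: integrable_fin_num => //; exact: bounded_measurable_integrable.
move/(ae_eq_integral_abs _ measurableT) => H.
have /H : measurable_fun setT
    (fun s => ((B s + - (a / 2)) * (B s + - (a / 2)))%:E).
  by apply/measurable_EFinP; case: bD.
by apply: filterS => s /(_ I) [] /eqP; rewrite mulf_eq0 orbb subr_eq0 => /eqP.
Qed.

End factored_kernel.

(** * Bernoulli's inequality for real exponents *)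

Section bernoulli.
Context (R : realType).
Implicit Types s y : R.

Lemma ln_leB1 y : 0 < y -> ln y <= y - 1.
Proof.
move=> y0; have := @le_ln1Dx R (y - 1).
by rewrite subrKC; apply; rewrite ltrBrDl subrr.
Qed.

(** Weighted AM-GM for y and 1. The bound [ln_leB1] is taken at y / z and at 1 / z with weights s
    and 1 - s; the right-hand sides add up to 0 because z = s y + (1 - s). *)
Lemma powR_le_affine s y : 0 < s -> s <= 1 -> 0 < y ->
  y `^ s <= 1 + s * (y - 1).
Proof.
move=> s0 s1 y0; set z := 1 + s * (y - 1).
have z0 : 0 < z.
  have : 0 < s * y by rewrite mulr_gt0.
  rewrite /z; lra.
rewrite /powR gt_eqF// -[leRHS](lnK z0) ler_expR.
have /(ler_wpM2l (ltW s0)) := ln_leB1 (divr_gt0 y0 z0).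
have s1' : 0 <= 1 - s by rewrite subr_ge0.
have z0V : 0 < z^-1 by rewrite invr_gt0.
have /(ler_wpM2l s1') := ln_leB1 z0V.
rewrite ln_div ?posrE// lnV ?posrE// => h1 h2.
have zz : s * (y / z - 1) + (1 - s) * (z^-1 - 1) = 0.
  by rewrite /z; field; rewrite gt_eqF.
lra.
Qed.

(** For s < 0, e^{s ln y} >= 1 + s ln y >= 1 + s (y - 1), where the second inequality multiplies ln
    y <= y - 1 by a negative number. *)
Lemma affine_le_powR s y : s < 0 -> 0 < y -> 1 + s * (y - 1) <= y `^ s.
Proof.
move=> s0 y0; rewrite /powR gt_eqF// (le_trans _ (expR_ge1Dx _))//.
by rewrite lerD2l ler_wnM2l ?(ltW s0)// ln_leB1.
Qed.

End bernoulli.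

(** * From the mean of the inverse potential to diversities of all orders *)

Section diversity_bound.
Context d (T : measurableType d) (R : realType) (dist : T -> T -> R).
Variables (mu : probability T R) (kappa W : R).
Local Notation g := (Kmeas dist mu).
Hypothesis bg : bounded_measurable g.
Hypothesis kappa0 : 0 < kappa.
Hypothesis g_ge : forall x, kappa <= g x.
Hypothesis W0 : 0 < W.
Hypothesis Rintegral_inv_g : \int[mu]_x (g x)^-1 <= W.

Let g0 x : 0 < g x. Proof. exact: lt_le_trans (g_ge x). Qed.

Let bln : bounded_measurable (fun x => ln (g x)).
Proof.
case: bg => mg [M Mg]; split.
  exact: (measurableT_comp (@measurable_ln R) mg).
exists (`|ln kappa| + `|ln M|) => x.
have gM : g x <= M by rewrite (le_trans (ler_norm _)).
have l1 : ln kappa <= ln (g x) by rewrite ler_ln ?posrE.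
have l2 : ln (g x) <= ln M by rewrite ler_ln ?posrE// (lt_le_trans (g0 x)).
rewrite ler_norml; apply/andP; split.
  have := ler_norm (- ln kappa); rewrite normrN; have := normr_ge0 (ln M); lra.
have := ler_norm (ln M); have := normr_ge0 (ln kappa); lra.
Qed.

Let bpow p : bounded_measurable (fun x => g x `^ p).
Proof.
case: bln => _ [N Nln]; split.
  by case: bg => mg _; exact: (measurableT_comp (measurable_powR _) mg).
exists (expR (`|p| * N)) => x; rewrite ger0_norm ?powR_ge0// /powR gt_eqF//.
by rewrite ler_expR (le_trans (ler_norm _))// normrM ler_wpM2l.
Qed.

Let bV : bounded_measurable (fun x => (g x)^-1).
Proof.
rewrite (_ : (fun _ => _) = (fun x => g x `^ (-1))) //.
by apply/funext => x; rewrite powR_inv1// ltW.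
Qed.

Let gV_affine s : \int[mu]_x (1 + s * ((g x)^-1 / W - 1)) =
  1 + s * (\int[mu]_x (g x)^-1 / W - 1).
Proof.
transitivity (\int[mu]_x (1 - s + s / W * (g x)^-1)).
  by apply: eq_Rintegral => x _; field; rewrite !gt_eqF.
rewrite bounded_RintegralD; [|by bounded..].
rewrite bounded_RintegralZl// Rintegral_probability_cst.
by field; rewrite gt_eqF.
Qed.

Let gV_W : \int[mu]_x (g x)^-1 / W - 1 <= 0.
Proof. by rewrite subr_le0 ler_pdivrMr// mul1r. Qed.

Let gpowE s x : g x `^ (- s) = W `^ s * ((g x)^-1 / W) `^ s.
Proof.
have gV0 : 0 < (g x)^-1 by rewrite invr_gt0.
rewrite -powRM ?divr_ge0 ?(ltW W0) ?(ltW gV0)//.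
by rewrite mulrC divfK ?gt_eqF// -powR_inv1 ?(ltW (g0 _))// -powRrM mulN1r.
Qed.

(** Put y = 1 / (W g), whose mean is at most 1, and s = 1 - q. For finite q other than 1 the
    diversity is W (\int y^s)^{1/s}. Bernoulli gives \int y^s <= 1 if s > 0 and \int y^s >= 1 if s <
    0, so the second factor is at most 1 in both cases. *)
Lemma diversity_le q : (0 <= q)%E -> diversity dist q mu <= W.
Proof.
case: q => [q| |] //; last first.
(* For q = +oo: g <= e almost everywhere, so 1 / e is at most the mean of 1 / g. That e is finite
   and positive ensures that [fine] keeps its value. *)
- move=> _ /=; set e := ess_sup _ _.
  have ege : (kappa%:E <= e)%E.
    apply: ess_sup_ger => //.
    by have /= -> := probability_setT mu; rewrite lte01.
  have [M eM] : exists M, (e <= M%:E)%E.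
    case: bg => _ [M Mg]; exists M; apply: ess_sup_ler => x.
    by rewrite lee_fin (le_trans (ler_norm _)).
  have efin : e \is a fin_num.
    by rewrite fin_numElt (lt_le_trans _ ege) ?ltNyr// (le_lt_trans eM)// ltry.
  have e0 : 0 < fine e.
    by rewrite -lte_fin fineK// (lt_le_trans _ ege) ?lte_fin.
  rewrite (le_trans _ Rintegral_inv_g)//.
  rewrite -[leLHS](Rintegral_probability_cst mu).
  have fV := integrable_fin_num measurableT
    (bounded_measurable_integrable mu bV).
  rewrite -lee_fin /Rintegral !fineK//; last first.
    apply: integrable_fin_num => //; apply: bounded_measurable_integrable.
    exact: bounded_measurable_cst.
  apply: ae_ge0_le_integral => //.
  + by move=> x _; rewrite lee_fin invr_ge0 ltW.
  + by move=> x _; rewrite lee_fin invr_ge0 ltW.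
  + by apply/measurable_EFinP; case: bV.
  have := ess_sup_ge mu (EFin \o g); apply: filterS => x /= + _.
  rewrite -/e -(fineK efin) !lee_fin => ge.
  by rewrite lef_pV2 ?posrE.
rewrite lee_fin => q0 /=; case: eqP => [_|/eqP q1].
  rewrite -[leRHS](lnK W0) ler_expR.
  have -> : - (\int[mu]_x ln (g x)) = \int[mu]_x (-1 * ln (g x)).
    by rewrite bounded_RintegralZl// mulN1r.
  (* For q = 1: - ln g = ln W + ln y <= ln W + (y - 1), with y - 1 written in the form that
     [gV_affine] integrates at s = 1. *)
  apply: (@le_trans _ _
      (\int[mu]_x (ln W + (1 + 1 * ((g x)^-1 / W - 1) - 1)))).
    apply: bounded_le_Rintegral; [by bounded..|] => x.
    have y0 : 0 < (g x)^-1 / W by rewrite divr_gt0// invr_gt0.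
    have := ln_leB1 y0.
    by rewrite ln_div ?posrE ?invr_gt0// lnV ?posrE//; lra.
  rewrite bounded_RintegralD; [|by bounded..].
  rewrite bounded_RintegralD; [|by bounded..].
  by rewrite !Rintegral_probability_cst gV_affine; move: gV_W; lra.
set s := 1 - q.
have s1 : s <= 1 by rewrite /s lerBlDr lerDl.
have qs : q - 1 = - s by rewrite /s opprB.
have sn0 : s != 0 by rewrite /s subr_eq0 eq_sym.
have Ws0 : 0 < W `^ s by rewrite powR_gt0.
have WsK : (W `^ s) `^ s^-1 = W.
  by rewrite -powRrM mulfV// powRr1// ltW.
have Ipow : \int[mu]_x g x `^ (q - 1) =
    W `^ s * \int[mu]_x ((g x)^-1 / W) `^ s.
  rewrite -bounded_RintegralZl.
    by apply: eq_Rintegral => x _; rewrite qs gpowE.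
  have -> : (fun x => ((g x)^-1 / W) `^ s) =
      (fun x => (W `^ s)^-1 * g x `^ (- s)).
    by apply/funext => x; rewrite gpowE mulKf// gt_eqF.
  by have := bpow (- s); bounded.
have bs : bounded_measurable (fun x => ((g x)^-1 / W) `^ s).
  have -> : (fun x => ((g x)^-1 / W) `^ s) =
      (fun x => (W `^ s)^-1 * g x `^ (- s)).
    by apply/funext => x; rewrite gpowE mulKf// gt_eqF.
  by have := bpow (- s); bounded.
have y0 x : 0 < (g x)^-1 / W by rewrite divr_gt0// invr_gt0.
have [s0|s0|/esym/eqP] := ltgtP 0 s; last by rewrite (negbTE sn0).
  rewrite -[leRHS]WsK ge0_ler_powR ?invr_ge0 ?(ltW s0) ?nnegrE ?powR_ge0//.
    by apply: Rintegral_ge0 => x _; exact: powR_ge0.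
  rewrite Ipow -[leRHS]mulr1 ler_wpM2l ?powR_ge0//.
  apply: (@le_trans _ _ (\int[mu]_x (1 + s * ((g x)^-1 / W - 1)))).
    apply: bounded_le_Rintegral => [//||x]; first by bounded.
    exact: powR_le_affine.
  by rewrite gV_affine gerDl pmulr_rle0.
have le1 : 1 <= \int[mu]_x ((g x)^-1 / W) `^ s.
  apply: (@le_trans _ _ (\int[mu]_x (1 + s * ((g x)^-1 / W - 1)))).
    by rewrite gV_affine lerDl mulr_le0 ?(ltW s0).
  apply: bounded_le_Rintegral => [|//|x]; first by bounded.
  exact: affine_le_powR.
have WI : W `^ s <= \int[mu]_x g x `^ (q - 1).
  by rewrite Ipow -[leLHS]mulr1 ler_wpM2l ?powR_ge0.
(* The exponent 1 / s is negative: passing to inverses of powers with exponent - 1 / s turns the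
   lower bound on the integral into an upper bound on the diversity. *)
rewrite -[leRHS]WsK -[s^-1]opprK !(powRN _ (- s^-1)) lef_pV2 ?posrE ?powR_gt0//.
  by rewrite ge0_ler_powR ?oppr_ge0 ?invr_le0 ?(ltW s0) ?nnegrE ?powR_ge0//
    (le_trans (powR_ge0 _ _) WI).
exact: lt_le_trans WI.
Qed.

End diversity_bound.

Lemma diversity_cst d (T : measurableType d) (R : realType) (dist : T -> T -> R)
    (mu : probability T R) (W : R) : 0 < W ->
  (forall x, Kmeas dist mu x = W^-1) ->
  forall q, (0 <= q)%E -> diversity dist q mu = W.
Proof.
move=> W0 KW q; have KE : Kmeas dist mu = cst W^-1 by exact/funext.
case: q => [q| |] //=; rewrite KE; last first.
  move=> _; rewrite ess_sup_cstr /= ?invrK//.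
  by have /= -> := probability_setT mu; rewrite lte01.
move=> _; rewrite /cst /=; case: eqP => [_|/eqP q1].
  by rewrite Rintegral_probability_cst lnV ?posrE// opprK lnK.
rewrite Rintegral_probability_cst -powR_inv1 ?(ltW W0)// -!powRrM.
have -> : -1 * ((q - 1) * (1 - q)^-1) = 1.
  by field; rewrite subr_eq0 eq_sym.
by rewrite powRr1// ltW.
Qed.

(** * Continuous functions on a compact metric space are bounded and Borel *)

Section borel.
Context (R : realType) (X : pmetricType R).

Lemma continuous_measurable_borel (f : X -> R) :
  continuous f -> measurable_fun setT (f : borel X -> R).
Proof.
move=> cf; apply: (measurability _ (@RGenOpens.measurableE R)).
move=> _ [_ [a [b ->]] <-]; rewrite setTI; apply: sub_sigma_algebra.
by move/continuousP : cf; apply; exact: interval_open.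
Qed.

Lemma continuous_bounded_borel (f : X -> R) : compact [set: X] ->
  continuous f -> bounded_measurable (f : borel X -> R).
Proof.
move=> cX cf; split; first exact: continuous_measurable_borel.
have : compact (f @` setT).
  by apply: continuous_compact => //; exact: continuous_subspaceT.
move/compact_bounded => [M [_ Mf]]; exists (M + 1) => x.
by apply: Mf; [rewrite ltrDl|exists x].
Qed.

End borel.

(** * Integration against normalised Lebesgue measure on the segment *)

Section segment.
Context (R : realType) (l : R) (l0 : 0 < l).
Local Notation X := (segment l0).
Local Notation v := (@seg_val R l l0).

Lemma seg_val_itv (x : X) : 0 <= v x <= l.
Proof. by have := set_valP x; rewrite /= in_itv. Qed.

Lemma continuous_seg_val : continuous v.
Proof. exact: initial_continuous. Qed.

Lemma measurable_seg_val_fun : measurable_fun setT (v : borel X -> R).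
Proof. exact: continuous_measurable_borel continuous_seg_val. Qed.

Let mv : measurable_fun setT (v : borel X -> measurableTypeR R).
Proof. exact: measurable_seg_val_fun. Qed.

Lemma image_preimage_seg_val (A : set R) : v @` (v @^-1` A) = `[0, l] `&` A.
Proof.
apply/seteqP; split=> [_ [x Ax <-]|y [y0l Ay]].
  by split => //; exact: set_valP.
by exists (exist _ y (mem_set y0l)).
Qed.

(** The pushforward of the measure along the inclusion [v] agrees with 1 / l times Lebesgue measure
    on the measurable subsets of [0, l]. *)
Lemma ge0_integral_normalised_lebesgue (f : R -> R) :
  measurable_fun setT f -> (forall y, 0 <= f y) ->
  (\int[normalised_lebesgue l0]_x (f (v x))%:E =
   l^-1%:E * \int[lebesgue_measure]_(y in `[0%R, l]) (f y)%:E)%E.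
Proof.
move=> mf f0.
have mfE : measurable_fun setT (EFin \o f) by exact/measurable_EFinP.
have lV0 : 0 <= l^-1 by rewrite invr_ge0 ltW.
transitivity (\int[pushforward (normalised_lebesgue l0)
    (v : borel X -> measurableTypeR R)]_(y in `[0%R, l]) (f y)%:E)%E.
  rewrite (ge0_integral_pushforward mv)//; last 2 first.
  - exact: measurable_funTS.
  - by move=> y _; rewrite lee_fin.
  have -> // : v @^-1` `[0, l] = setT.
  by rewrite -subTset => x _; have := seg_val_itv x; rewrite /= in_itv.
transitivity (\int[mscale (NngNum lV0) (@lebesgue_measure R)]_(y in `[0%R, l])
    (f y)%:E)%E; last first.
  rewrite ge0_integral_mscale//=; last by move=> y _; rewrite lee_fin.
  exact: measurable_funTS.
apply: eq_measure_integral => A mA A0l.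
rewrite /= /pushforward normalised_lebesgueE.
by rewrite image_preimage_seg_val (setIidr A0l) muleC.
Qed.

(** The one explicit integral of the proof: layers, products of two layers and the kernel itself all
    reduce to it, the kernel also with negative c. A primitive is - E / c. *)
Lemma Rintegral_expR_segment (a b c p : R) :
  0 <= a -> a <= b -> b <= l -> c != 0 ->
  \int[normalised_lebesgue l0]_x
    (if a <= v x <= b then expR (- c * (v x - p)) else 0) =
  (expR (- c * (a - p)) - expR (- c * (b - p))) / (c * l).
Proof.
move=> a0 ab bl c0.
pose E (y : R) := expR (- c * (y - p)).
have dE (y : R) : is_derive y 1 E (- c * E y).
  have dA : is_derive y 1 (fun y => - c * (y - p)) (- c * (1 - 0)).
    exact: (@is_deriveZ _ _ _ (fun y : R => y - p) (- c)).
  rewrite (_ : - c * E y = E y * (- c * (1 - 0))); last first.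
    by rewrite subr0 mulr1 mulrC.
  exact: (@is_derive1_comp R expR _ y _ _ (is_derive_expR _) dA).
have cE : continuous E.
  move=> y; apply/differentiable_continuous/derivable1_diffP.
  by apply: ex_derive; exact: dE.
have mE : measurable_fun setT E by exact: continuous_measurable_fun.
pose f (y : R) := if a <= y <= b then E y else 0.
have f0 y : 0 <= f y by rewrite /f; case: ifP => // _; exact: expR_ge0.
have fE : f = E \_ `[a, b].
  apply/funext => y; rewrite patchE /f; case: ifPn => h.
    by rewrite mem_set//= in_itv.
  by rewrite memNset//= in_itv/=; exact/negP.
have mf : measurable_fun setT f.
  rewrite fE; apply/(measurable_restrictT _ _).1 => //.
  exact: measurable_funTS.
rewrite /Rintegral (ge0_integral_normalised_lebesgue mf f0).
transitivity
  (fine (l^-1%:E * \int[lebesgue_measure]_(y in `[a, b]) (E y)%:E)%E).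
  congr (fine (_ * _)%E).
  rewrite [LHS]integral_mkcond [RHS]integral_mkcond; apply: eq_integral => y _.
  rewrite /= !patchE fE patchE.
  case: ifPn => // hl.
    by case: ifPn.
  rewrite memNset//= in_itv/= => /andP[ay yb].
  move: hl; rewrite notin_setE /= in_itv /=; apply.
  by rewrite (le_trans a0 ay) (le_trans yb bl).
(* The fundamental theorem of calculus is applied for a < b; for a = b both sides are 0. *)
have [->|ab'] := eqVneq a b.
  by rewrite set_itv1 integral_set1 mule0 subrr mul0r.
have {}ab' : a < b by rewrite lt_neqAle ab'.
rewrite (@continuous_FTC2 _ E (fun y => - c^-1 * E y) a b) //.
- rewrite -EFinB -EFinM /= /E; field; rewrite c0 gt_eqF//.
- exact: continuous_subspaceT.
- split.
  + by move=> y _; apply: derivableM => //; apply: ex_derive; exact: dE.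
  + by apply: cvg_at_right_filter; apply: cvgM; [exact: cvg_cst|exact: cE].
  + by apply: cvg_at_left_filter; apply: cvgM; [exact: cvg_cst|exact: cE].
- move=> y _; rewrite derive1E derive_val.
  by rewrite /GRing.scale/= mulrA mulrNN mulVf// mul1r.
Qed.

End segment.

(** * The layers of the exponential kernel on the segment *)

Section exponential_segment.
Context (R : realType) (l : R) (l0 : 0 < l) (t : R) (t0 : 0 < t).
Local Notation X := (segment l0).
Local Notation v := (@seg_val R l l0).
Local Notation m := (normalised_lebesgue l0).

Let l_itv : l \in (`[0, l]%classic : set R).
Proof. by rewrite inE /= in_itv /= lexx ltW. Qed.

Definition seg_top : X := exist _ l l_itv.

Definition seg_layer (s x : borel X) : R :=
  if v x <= v s then expR (- t * (v s - v x)) else 0.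
Local Notation phi := seg_layer.

Let l_neq0 : l != 0. Proof. by rewrite gt_eqF. Qed.
Let t_neq0 : t != 0. Proof. by rewrite gt_eqF. Qed.
Let v_ge0 x : 0 <= v x. Proof. by case/andP: (seg_val_itv x). Qed.
Let v_lel x : v x <= l. Proof. by case/andP: (seg_val_itv x). Qed.
Let mv := @measurable_seg_val_fun R l l0.

Lemma measurable_seg_layer :
  measurable_fun setT (fun p : borel X * borel X => phi p.1 p.2).
Proof.
have m1 : measurable_fun setT (fun p : borel X * borel X => v p.1).
  exact: (measurableT_comp mv measurable_fst).
have m2 : measurable_fun setT (fun p : borel X * borel X => v p.2).
  exact: (measurableT_comp mv measurable_snd).
apply: measurable_fun_ifT => //; first exact: measurable_fun_ler.
apply: measurableT_comp => //; apply: measurable_funM => //.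
exact: measurable_funB.
Qed.

Lemma seg_layer01 s x : 0 <= phi s x <= 1.
Proof.
rewrite /seg_layer; case: ifP => h; last by rewrite lexx ler01.
by rewrite expR_ge0 -expR0 ler_expR mulNr oppr_le0 mulr_ge0 ?subr_ge0// ltW.
Qed.

Lemma seg_layer_top x : phi seg_top x = expR (- t * (l - v x)).
Proof. by rewrite /seg_layer v_lel. Qed.

Lemma seg_layer_top_ge x : expR (- (t * l)) <= phi seg_top x.
Proof.
rewrite seg_layer_top ler_expR mulNr lerN2 ler_wpM2l ?(ltW t0)//.
by rewrite gerBl.
Qed.

(** For x <= r, the integral of t e^{-t(s-x)} over s from x to r is 1 - e^{-t(r-x)}; for x > r
    everything vanishes. The case of the right end point is [seg_layer_sum]; general r serves to
    recover a distribution function from layer masses. *)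
Lemma seg_layer_indicator (r x : X) :
  (if v x <= v r then 1 else 0) =
  phi r x + t * l * \int[m]_s (if v s <= v r then phi s x else 0).
Proof.
rewrite {1}/seg_layer; case: ifP => [xr|/negbT xr]; last first.
  rewrite (_ : (fun s => _) = (fun=> 0)); last first.
    apply/funext => s; rewrite /seg_layer.
    case: ifP => // sr; case: ifP => // xs.
    by rewrite (le_trans xs sr) in xr.
  by rewrite Rintegral_probability_cst mulr0 addr0.
rewrite (_ : (fun s => _) =
    (fun s => if v x <= v s <= v r then expR (- t * (v s - v x)) else 0)).
  rewrite Rintegral_expR_segment// subrr mulr0 expR0.
  by field; rewrite t_neq0 l_neq0.
apply/funext => s; rewrite /seg_layer.
by case: (v s <= v r); rewrite ?andbT ?andbF.
Qed.

Lemma seg_layer_sum x : phi seg_top x + t * l * \int[m]_s phi s x = 1.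
Proof.
have := seg_layer_indicator seg_top x; rewrite v_lel => ->.
by congr (_ + _ * _); apply: eq_Rintegral => s _; rewrite v_lel.
Qed.

(** For x <= y both layers are nonzero exactly when s >= y, and their product is e^{-2t(s-(x+y)/2)}.
    Its integral from y to l yields e^{-t(y-x)} minus the product of the two top layers. *)
Lemma seg_layer_kernel x y :
  expR (- scaled_dist t x y) = phi seg_top x * phi seg_top y +
    2 * (t * l) * \int[m]_s (phi s x * phi s y).
Proof.
rewrite /scaled_dist mdist_segment.
wlog xy : x y / v x <= v y.
  move=> H; have [|/ltW] := leP (v x) (v y); first exact: H.
  move/H => Hyx; rewrite distrC Hyx mulrC; congr (_ + _ * _).
  by apply: eq_Rintegral => s _; rewrite mulrC.
rewrite distrC ger0_norm ?subr_ge0//.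
rewrite (_ : (fun s => _) = (fun s => if v y <= v s <= l
    then expR (- (2 * t) * (v s - (v x + v y) / 2)) else 0)); last first.
  apply/funext => s; rewrite /seg_layer v_lel andbT.
  case: (leP (v y) (v s)) => ys; last by rewrite mulr0.
  by rewrite (le_trans xy ys) -expRD; congr expR; field.
rewrite Rintegral_expR_segment//; last by rewrite mulf_neq0// pnatr_eq0.
rewrite !seg_layer_top -expRD.
have -> : - t * (l - v x) + - t * (l - v y) =
  - (2 * t) * (l - (v x + v y) / 2) by field.
have -> : - (t * (v y - v x)) = - (2 * t) * (v y - (v x + v y) / 2) by field.
by field; rewrite t_neq0 l_neq0.
Qed.

Lemma bounded_kernel x :
  bounded_measurable (fun y : borel X => expR (- scaled_dist t x y)).
Proof.
split; last first.
  exists 1 => y; rewrite ger0_norm ?expR_ge0// -expR0 ler_expR oppr_le0.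
  by rewrite /scaled_dist mdist_segment mulr_ge0// ltW.
apply: measurableT_comp => //; apply: measurableT_comp => //.
apply: measurable_funM => //.
have md : measurable_fun setT (fun y : borel X => `|v x - v y|).
  apply: measurableT_comp => //.
  exact: (measurable_funB (measurable_cst _) mv).
exact: md.
Qed.

Lemma Rintegral_kernel_lebesgue x :
  t * l * \int[m]_y expR (- scaled_dist t x y) =
  2 - expR (- t * v x) - expR (- t * (l - v x)).
Proof.
have bexp (c : R) :
    bounded_measurable (fun y : borel X => expR (- c * (v y - v x))).
  split.
    apply: measurableT_comp => //; apply: measurable_funM => //.
    by apply: measurable_funB.
  exists (expR (`|c| * l)) => y; rewrite ger0_norm ?expR_ge0// ler_expR.
  rewrite (le_trans (ler_norm _))// normrM normrN ler_wpM2l//.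
  rewrite ler_norml; have := v_ge0 x; have := v_lel x.
  by have := v_ge0 y; have := v_lel y; lra.
pose f c a b := fun y : X =>
  if a <= v y <= b then expR (- c * (v y - v x)) else 0.
have bf c a b : bounded_measurable (f c a b : borel X -> R).
  apply: bounded_measurable_if => //; last exact: bounded_measurable_cst.
  by apply: measurable_and; apply: measurable_fun_ler.
(* The kernel is split at x into a rising and a falling exponential. Both pieces contain the point
   x, so it is subtracted once; that third piece has integral 0. *)
rewrite (_ : (fun y => _) = (fun y => f (- t) 0 (v x) y + f t (v x) l y +
    -1 * f t (v x) (v x) y)); last first.
  apply/funext => y; rewrite /scaled_dist mdist_segment /f v_ge0 v_lel andbT /=.
  case: ltgtP => [xy|xy|->].
  - by rewrite mulr0 !addr0 opprK ger0_norm ?subr_ge0 1?ltW// -mulrN opprB.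
  - by rewrite mulr0 add0r addr0 distrC ger0_norm ?subr_ge0 1?ltW// mulNr.
  - by rewrite subrr normr0 !mulr0 oppr0 mulN1r addrK.
rewrite !bounded_RintegralD; [|by bounded..].
rewrite bounded_RintegralZl// !Rintegral_expR_segment ?oppr_eq0//.
rewrite !subrr !mulr0 !expR0 opprK sub0r mulrN -(mulNr t (v x)).
by field; rewrite t_neq0 l_neq0.
Qed.

End exponential_segment.

(** * The balanced measure, its constant potential and its limit *)

Section balanced_measure.
Context (R : realType) (l : R) (l0 : 0 < l).
Local Notation X := (segment l0).
Local Notation v := (@seg_val R l l0).
Local Notation m := (normalised_lebesgue l0).
Local Notation bot := (point : borel X).
Local Notation top := (seg_top l0 : borel X).

(** The absolute value makes the coefficient nonnegative for every real t, as [mscale] requires; it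
    equals t l for t > 0. *)
Definition balanced_mass (t : R) :=
  measure_add (dirac bot)
    (measure_add (dirac top) (mscale (NngNum (normr_ge0 (t * l))) m)).

Definition balanced_measure (t : R) : prob X :=
  mnormalize (balanced_mass t) (dirac bot).

Lemma balanced_massT t : 0 < t -> balanced_mass t setT = (2 + t * l)%:E.
Proof.
move=> t0; rewrite /balanced_mass measure_addE [X in (_ + X)%E]measure_addE.
have mT : (`|t * l|%:E * m setT = (t * l)%:E)%E.
  rewrite [X in (_ * X)%E](probability_setT m) mule1.
  by rewrite ger0_norm ?mulr_ge0 ?(ltW t0) ?(ltW l0).
transitivity (1 + (1 + (t * l)%:E))%E; last by rewrite -!EFinD addrA.
by congr (_ + (_ + _))%E; [exact: diracT|exact: diracT|exact: mT].
Qed.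

Lemma ge0_integral_balanced_mass t (f : borel X -> R) : 0 < t ->
  measurable_fun setT f -> (forall x, 0 <= f x) ->
  (\int[balanced_mass t]_x (f x)%:E =
   (f bot)%:E + ((f top)%:E + (t * l)%:E * \int[m]_x (f x)%:E))%E.
Proof.
move=> t0 mf f0.
have mfE : measurable_fun setT (EFin \o f) by exact/measurable_EFinP.
have fE0 x : setT x -> (0 <= (f x)%:E)%E by rewrite lee_fin.
rewrite ge0_integral_measure_add// ge0_integral_measure_add//.
rewrite ge0_integral_mscale//= ger0_norm ?mulr_ge0 ?(ltW t0) ?(ltW l0)//.
by rewrite !integral_dirac// !diracT !mul1e.
Qed.

Let ge0_Rintegral_balanced t (f : borel X -> R) : 0 < t ->
  bounded_measurable f -> (forall x, 0 <= f x) ->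
  \int[balanced_measure t]_x f x =
  (f bot + f top + t * l * \int[m]_x f x) / (2 + t * l).
Proof.
move=> t0 bf f0; have mf := bf.1.
have W0 : 0 < 2 + t * l by rewrite addr_gt0 ?mulr_gt0.
have WV0 : 0 <= (2 + t * l)^-1 by rewrite invr_ge0 ltW.
have mfE : measurable_fun setT (EFin \o f) by exact/measurable_EFinP.
rewrite /Rintegral.
transitivity (fine (\int[mscale (NngNum WV0) (balanced_mass t)]_x (f x)%:E)).
  congr fine; apply: eq_measure_integral => A mA _.
  transitivity ((if (balanced_mass t setT == 0) || (balanced_mass t setT == +oo)
    then dirac bot else fun U => balanced_mass t U *
      (fine (balanced_mass t setT))^-1%:E) A)%E; first by [].
  by rewrite balanced_massT// eqe gt_eqF//= muleC.
rewrite ge0_integral_mscale//; last by move=> x _; rewrite lee_fin.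
rewrite ge0_integral_balanced_mass//.
have := integrable_fin_num measurableT (bounded_measurable_integrable m bf).
rewrite /comp; case: (\int[m]_x (f x)%:E)%E => // r _.
by rewrite /= mulrC addrA.
Qed.

(** Adding the bound M reduces to nonnegative f; both sides then change by M, since the weights 1, 1
    and t l sum to 2 + t l. *)
Lemma Rintegral_balanced t (f : borel X -> R) : 0 < t ->
  bounded_measurable f ->
  \int[balanced_measure t]_x f x =
  (f bot + f top + t * l * \int[m]_x f x) / (2 + t * l).
Proof.
move=> t0 bf; have [_ [M Mf]] := bf.
have W0 : 0 < 2 + t * l by rewrite addr_gt0 ?mulr_gt0.
have bM := bounded_measurable_cst (borel X) M.
have bfM : bounded_measurable (fun x => f x + M) by exact: bounded_measurableD.
have f0 x : 0 <= f x + M.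
  by have := Mf x; rewrite ler_norml -subr_ge0 opprK addrC; case/andP.
have := ge0_Rintegral_balanced t0 bfM f0.
rewrite !bounded_RintegralD// !Rintegral_probability_cst => H.
apply: (addIr M); rewrite H; field.
by rewrite gt_eqF.
Qed.

(** With I the Lebesgue mean of f, the error is exactly (2 I - f(0) - f(l)) / (2 + t l), which tends
    to 0. *)
Lemma cvg_balanced_measure : balanced_measure t @[t --> +oo] --> (m : prob X).
Proof.
apply/cvg_weak_star => f.
have bf : bounded_measurable (f : borel X -> R).
  apply: continuous_bounded_borel; first exact: compact_segment.
  exact: cts_fun.
rewrite /integration; set I := \int[m]_x f x.
pose C := `|f bot + f top - 2 * I|.
change (\int[balanced_measure t]_x f x @[t --> +oo] --> I).
apply/cvgrPdist_le => e e0; near=> t.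
have t0 : 0 < t by near: t; exact: nbhs_pinfty_gt.
have W0 : 0 < 2 + t * l by rewrite addr_gt0 ?mulr_gt0.
rewrite Rintegral_balanced// -/I.
have -> : I - (f bot + f top + t * l * I) / (2 + t * l) =
    - (f bot + f top - 2 * I) / (2 + t * l) by field; rewrite gt_eqF.
rewrite normrM normrN -/C normfV (gtr0_norm W0) ler_pdivrMr//.
have Ct : C / (e * l) <= t by near: t; apply: nbhs_pinfty_ge; exact: num_real.
rewrite mulrDr ler_wpDl ?mulr_ge0 ?(ltW e0)//.
by rewrite mulrCA -ler_pdivrMr ?mulr_gt0.
Unshelve. all: by end_near. Qed.

(** The two point masses contribute e^{-tx} and e^{-t(l-x)}, precisely what the Lebesgue part lacks
    to the constant 2. *)
Lemma Kmeas_balanced t x : 0 < t ->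
  Kmeas (scaled_dist t) (balanced_measure t) x = (1 + t * l / 2)^-1.
Proof.
move=> t0; have W0 : 0 < 2 + t * l by rewrite addr_gt0 ?mulr_gt0.
rewrite /Kmeas Rintegral_balanced//; last first.
  exact: bounded_kernel.
rewrite Rintegral_kernel_lebesgue//.
rewrite /scaled_dist !mdist_segment.
have -> : v bot = 0 by [].
have -> : v top = l by [].
case/andP: (@seg_val_itv R l l0 x) => x0 xl.
rewrite subr0 ger0_norm// ler0_norm ?subr_le0// opprB !mulNr.
by field; rewrite !gt_eqF// ?addr_gt0// divr_gt0// mulr_gt0.
Qed.

End balanced_measure.

(** * A probability on the segment is determined by almost all of its upper tails *)

Section cumulative.
Context (R : realType) (l : R) (l0 : 0 < l).
Local Notation X := (segment l0).
Local Notation v := (@seg_val R l l0).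
Local Notation m := (normalised_lebesgue l0).
Local Notation upper r := (v @^-1` `]r, +oo[).
Implicit Types nu mu : prob X.

Lemma measurable_upper r : measurable (upper r : set (borel X)).
Proof.
rewrite -[upper r]setTI; apply: (@measurable_seg_val_fun R l l0) => //.
Qed.

(** An interval of positive length is not a null set, so it meets every set of full measure. *)
Lemma ae_normalised_lebesgue_itv (P : X -> Prop) (r e : R) :
  {ae m, forall s, P s} -> 0 <= r -> r < l -> 0 < e ->
  exists s, [/\ P s, r < v s & v s < r + e].
Proof.
move=> [N [mN N0 PN]] r0 rl e0; apply: contrapT => noP.
(* The minimum with l keeps the interval inside the segment, where its measure is (b - r) / l. *)
pose b := Num.min l (r + e).
have rb : r < b by rewrite lt_min rl ltrDl.
have bl : b <= l by rewrite ge_min lexx.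
have mI : measurable (v @^-1` `]r, b[ : set (borel X)).
  by rewrite -[v @^-1` _]setTI; apply: (@measurable_seg_val_fun R l l0).
have : (m (v @^-1` `]r, b[) <= 0)%E.
  rewrite -N0; apply: le_measure; rewrite ?inE// => s.
  rewrite /= in_itv /= => /andP[rs sb]; apply: PN => /= Ps.
  apply: noP; exists s; split => //; apply: lt_le_trans sb _.
  by rewrite ge_min lexx orbT.
rewrite normalised_lebesgueE image_preimage_seg_val setIidr; last first.
  move=> y /=; rewrite !in_itv /= => /andP[ry yb].
  by rewrite (le_trans r0 (ltW ry)) (le_trans (ltW yb) bl).
rewrite lebesgue_measure_itv /= lte_fin rb -EFinB -EFinM lee_fin.
by rewrite leNgt mulr_gt0 ?subr_gt0 ?invr_gt0.
Qed.

(** The tail beyond r is the increasing union of the tails beyond r + 1 / (n + 1). Between these two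
    thresholds lies a point s where the tails of [nu] and [mu] agree, and monotonicity on either
    side of s gives the inequality. *)
Lemma le_upper nu mu r :
  {ae m, forall s, nu (upper (v s)) = mu (upper (v s))} ->
  (nu (upper r) <= mu (upper r))%E.
Proof.
move=> numu.
have [r0|r0] := ltP r 0.
  have -> : upper r = setT.
    rewrite -subTset => x _ /=; rewrite in_itv /= andbT (lt_le_trans r0)//.
    by case/andP: (@seg_val_itv R l l0 x).
  by rewrite [leLHS]probability_setT [leRHS]probability_setT.
have [rl|lr] := ltP r l; last first.
  have -> : upper r = set0.
    rewrite -subset0 => x /=; rewrite in_itv /= andbT ltNge => /negP; apply.
    by apply: le_trans lr; case/andP: (@seg_val_itv R l l0 x).
  by rewrite !measure0.
pose F (n : nat) : set (borel X) := upper (r + n.+1%:R^-1).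
have UF : \bigcup_n F n = upper r.
  apply/seteqP; split=> [x [n _]|x]; rewrite /F /= !in_itv /= !andbT.
    by apply: lt_trans; rewrite ltrDl invr_gt0.
  move=> rx; have d0 : 0 < v x - r by rewrite subr_gt0.
  exists (Num.bound (v x - r)^-1) => //; rewrite /F /= in_itv /= andbT -ltrBrDl.
  rewrite invf_plt ?posrE//.
  rewrite (lt_trans (archi_boundP _))// ?invr_ge0 ?(ltW d0)//.
  by rewrite ltr_nat.
have nuF : nu \o F @ \oo --> nu (upper r).
  rewrite -UF; apply: nondecreasing_cvg_mu => //.
  - by move=> n; exact: measurable_upper.
  - by rewrite UF; exact: measurable_upper.
  - move=> i j ij; apply/subsetPset => x; rewrite /F /= !in_itv /= !andbT.
    by apply: le_lt_trans; rewrite lerD2l lef_pV2 ?posrE// ler_nat.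
rewrite -(cvg_lim _ nuF)//; apply: lime_le; first by apply/cvgP: nuF.
apply: nearW => n /=.
have n0 : 0 < (n.+1%:R^-1 : R) by rewrite invr_gt0.
have [s [nums rs srn]] := ae_normalised_lebesgue_itv numu r0 rl n0.
apply: (@le_trans _ _ (nu (upper (v s)))).
  apply: le_measure; rewrite ?inE; [exact: measurable_upper..|].
  by move=> x; rewrite /F /= !in_itv /= !andbT; exact: lt_trans.
rewrite nums; apply: le_measure; rewrite ?inE; [exact: measurable_upper..|].
by move=> x /=; rewrite !in_itv /= !andbT; exact: lt_trans.
Qed.

(** Applying [le_upper] in both directions makes all tails equal. Open upper half-lines are closed
    under intersection and generate the Borel sets of the line, so the pushforwards along [v] agree;
    injectivity of [v] carries this back to the segment. *)
Lemma probability_segment_eq nu mu :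
  {ae m, forall s, nu (upper (v s)) = mu (upper (v s))} ->
  forall A, measurable A -> nu A = mu A.
Proof.
move=> numu A mA.
have eq_upper r : nu (upper r) = mu (upper r).
  apply/eqP; rewrite eq_le !le_upper//.
  case: numu => N [mN N0 numuN]; exists N; split => // s /= neq.
  by apply: numuN => /= eqs; apply: neq.
have mv := @measurable_seg_val_fun R l l0.
have AE : v @^-1` (v @` A) = A.
  apply/seteqP; split=> [x [y Ay /val_inj <-//]|x Ax]; by exists x.
rewrite -AE.
have mvA : measurable (v @` A) := measurable_seg_val mA.
pose nuR := pushforward nu (v : borel X -> R).
pose muR := pushforward mu (v : borel X -> R).
apply: (@measure_unique _ R R (@RGenOInfty.G R)
  (fun n => `]- n%:R, +oo[%classic) (@RGenOInfty.measurableE R) _ _ _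
  nuR muR _ _ (v @` A) mvA) => //.
- move=> _ _ [x ->] [y ->]; exists (Num.max x y).
  by apply/seteqP; split=> z /=; rewrite !in_itv /= !andbT gt_max => /andP.
- by move=> n; exists (- n%:R).
- rewrite -subTset => x _; exists (Num.bound `|x|) => //=.
  rewrite in_itv /= andbT ltrNl (le_lt_trans _ (archi_boundP _))//.
  by rewrite -normrN ler_norm.
- by move=> _ [r ->]; exact: eq_upper.
- move=> n; rewrite /nuR /pushforward.
  rewrite (le_lt_trans (probability_le1 _ _)) ?ltry//.
  exact: measurable_upper.
Qed.

End cumulative.

(** * Maximality and uniqueness of the balanced measure at a fixed scale *)

Section uniform.
Context (R : realType) (l : R) (l0 : 0 < l).
Local Notation X := (segment l0).
Local Notation v := (@seg_val R l l0).
Local Notation m := (normalised_lebesgue l0).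
Local Notation upper r := (v @^-1` `]r, +oo[).

Section fixed_scale.
Variables (t : R) (t0 : 0 < t).
Local Notation phi := (@seg_layer R l l0 t).
Local Notation top := (seg_top l0).
Local Notation dist := (@scaled_dist R X t).

Let W0 : 0 < 1 + t * l / 2.
Proof. by rewrite ltr_pwDr// divr_gt0// mulr_gt0. Qed.
Let tl0 : 0 < t * l. Proof. by rewrite mulr_gt0. Qed.
Let mphi := @measurable_seg_layer R l l0 t.
Let phi01 := @seg_layer01 R l l0 t t0.
Let phi_sum := @seg_layer_sum R l l0 t t0.

Lemma Kmeas_segment (nu : prob X) :
  Kmeas dist nu = factored_potential m phi top (t * l) nu.
Proof.
apply/funext => x.
rewrite -(Rintegral_factored_kernel m top (t * l) mphi phi01).
by apply: eq_Rintegral => y _; exact: seg_layer_kernel.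
Qed.

Lemma diversity_segment_le (nu : prob X) q : (0 <= q)%E ->
  diversity dist q nu <= 1 + t * l / 2.
Proof.
have k0 := expR_gt0 (- (t * l)).
have ktop := @seg_layer_top_ge R l l0 t t0.
apply: (@diversity_le _ _ _ _ _ (expR (- (t * l)) ^+ 2)) => //.
- by rewrite Kmeas_segment; exact: bounded_factored_potential.
- by rewrite exprn_gt0.
- move=> x; rewrite Kmeas_segment; exact: factored_potential_ge.
- rewrite Kmeas_segment.
  exact: (Rintegral_inv_factored_potential_le mphi phi01 k0 ktop tl0 phi_sum
    nu).
Qed.

Lemma diversity_balanced q : (0 <= q)%E ->
  diversity dist q (balanced_measure l0 t) = 1 + t * l / 2.
Proof. by apply: diversity_cst => // x; exact: Kmeas_balanced. Qed.

Lemma maximising_balanced : maximising dist (balanced_measure l0 t).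
Proof.
by move=> q q0 nu; rewrite diversity_balanced// diversity_segment_le.
Qed.

(* At q = 2 the diversity is the inverse of the energy. *)
Lemma maximising_energy (nu : prob X) : maximising dist nu ->
  \int[nu]_x Kmeas dist nu x <= (1 + t * l / 2)^-1.
Proof.
move=> /(_ 2%:E); rewrite lee_fin => /(_ (ler0n _ 2) (balanced_measure l0 t)).
rewrite diversity_balanced ?lee_fin//= (pnatr_eq1 R 2) /=.
have -> : (2 - 1 : R) = 1 by ring.
have -> : (1 - 2 : R)^-1 = -1 by field.
have K0 x : 0 <= Kmeas dist nu x.
  by apply: Rintegral_ge0 => y _; exact: expR_ge0.
have -> : (fun x => Kmeas dist nu x `^ 1) = Kmeas dist nu.
  by apply/funext => x; rewrite powRr1.
have I0 : 0 <= \int[nu]_x Kmeas dist nu x by exact: Rintegral_ge0.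
rewrite powR_inv1// => WI; have WI0 := lt_le_trans W0 WI.
by rewrite -[leLHS]invrK lef_pV2 ?posrE.
Qed.

(** The energy bound makes the layer masses almost everywhere a / 2. Integrating
    [seg_layer_indicator] against [nu] expresses the mass of [0, s] through layer masses, so the
    tail takes a value in which [nu] no longer occurs. *)
Lemma maximising_upper (nu : prob X) : maximising dist nu ->
  {ae m, forall s, nu (upper (v s)) = (1 - (1 + t * l / 2)^-1 / 2 *
    (1 + t * l * \int[m]_u (if v u <= v s then 1 else 0)))%:E}.
Proof.
move=> /maximising_energy; set a := (1 + t * l / 2)^-1 => energy.
have aeB : {ae m, forall s, layer_mass phi nu s = a / 2}.
  apply: (layer_mass_minimal mphi phi01 tl0 phi_sum).
  by rewrite -Kmeas_segment.
have bB := bounded_layer_mass mphi phi01 nu.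
have mv := @measurable_seg_val_fun R l l0.
have bind (r : R) (f : borel X -> R) : bounded_measurable f ->
    bounded_measurable (fun u : borel X => if v u <= r then f u else 0).
  move=> bf; apply: bounded_measurable_if => //;
    last exact: bounded_measurable_cst.
  exact: measurable_fun_ler.
have cumul s : \int[nu]_x (if v x <= v s then 1 else 0) =
    layer_mass phi nu s +
    t * l * \int[m]_u (if v u <= v s then layer_mass phi nu u else 0).
  have bone := bind (v s) _ (bounded_measurable_cst (borel X) 1).
  have bphi u : bounded_measurable (phi u).
    split; first exact: (measurableT_comp mphi (pair1_measurable u)).
    by exists 1 => x; case/andP: (phi01 u x) => ? ?; rewrite ger0_norm.
  transitivity (\int[nu]_x (phi s x +
      t * l * \int[m]_u (phi u x * (if v u <= v s then 1 else 0)))).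
    apply: eq_Rintegral => x _; rewrite (seg_layer_indicator t0).
    congr (_ + _ * _); apply: eq_Rintegral => u _.
    by case: ifP; rewrite ?mulr1 ?mulr0.
  have bint : bounded_measurable (fun x : borel X =>
      \int[m]_u (phi u x * (if v u <= v s then 1 else 0))).
    exact: bounded_Rintegral_layers.
  rewrite bounded_RintegralD//; last by bounded.
  rewrite bounded_RintegralZl// (Rintegral_layers m mphi phi01 nu bone).
  congr (_ + _ * _); apply: eq_Rintegral => u _.
  by case: ifP; rewrite ?mulr1 ?mulr0.
(* Under the integral, almost everywhere equality suffices for replacing the layer mass by a / 2. *)
have aeI s : \int[m]_u (if v u <= v s then layer_mass phi nu u else 0) =
    a / 2 * \int[m]_u (if v u <= v s then 1 else 0).
  rewrite -bounded_RintegralZl; last first.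
    exact: bind (bounded_measurable_cst _ 1).
  rewrite /Rintegral; congr fine; apply: ae_eq_integral => //.
  - by apply/measurable_EFinP; case: (bind (v s) _ bB).
  - apply/measurable_EFinP; apply: measurable_funM => //.
    by case: (bind (v s) _ (bounded_measurable_cst (borel X) 1)).
  - case: aeB => N [mN N0 NB]; exists N; split => // u /= neq.
    apply: NB => /= eqB.
    by apply: neq => _; case: ifP; rewrite ?eqB ?mulr1 ?mulr0.
have tail s : nu (upper (v s)) =
    (1 - \int[nu]_x (if v x <= v s then 1 else 0))%:E.
  have UE : upper (v s) = ~` [set x | v x <= v s].
    by apply/seteqP; split=> x /=; rewrite in_itv /= andbT ltNge => /negP.
  have mL : measurable ([set x | v x <= v s] : set (borel X)).
    rewrite -[X in measurable X]setCK -UE; apply: measurableC.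
    exact: measurable_upper.
  rewrite UE [LHS]probability_setC// EFinB; congr (_ - _)%E.
  rewrite /Rintegral (_ : (fun x => _) =
      (fun x => (\1_([set x | v x <= v s] : set (borel X)) x)%:E)); last first.
    apply/funext => x; rewrite indicE; case: ifPn => xs.
      by rewrite mem_set.
    by rewrite memNset//; exact/negP.
  by rewrite integral_indic// setIT fineK// fin_num_measure.
(* The remaining term of [cumul] is the layer mass at s itself, which is a / 2 only off the null set
   N. *)
case: aeB => N [mN N0 NB]; exists N; split => // s /= neq; apply: NB => /= eqB.
by apply: neq; rewrite tail cumul eqB aeI; congr (_%:E); ring.
Qed.

(** Off the union of two null sets, the tails of [nu] and of the balanced measure are given by the
    same formula. *)
Lemma unique_maximising_balanced :
  unique_maximising dist (balanced_measure l0 t).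
Proof.
split; first exact: maximising_balanced.
move=> nu /maximising_upper nuE; apply: probability_segment_eq.
have := maximising_upper maximising_balanced.
move: nuE => [N [mN N0 NE]] [M [mM M0 ME]]; exists (N `|` M); split.
- exact: measurableU.
- exact: null_set_setU.
- move=> s /= neq; apply: contrapT => /not_orP [nN nM]; apply: neq.
  have -> := contra_notP (NE s) nN; symmetry.
  exact: contra_notP (ME s) nM.
Qed.

End fixed_scale.

End uniform.

Theorem proposition9p6 (R : realType) (l : R) (l0 : 0 < l) :
  is_uniform_measure (normalised_lebesgue l0).
Proof.
exists (balanced_measure l0); split; last exact: cvg_balanced_measure.
near=> t; apply: unique_maximising_balanced.
near: t; exact: nbhs_pinfty_gt.
Unshelve. all: by end_near. Qed.
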